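(* Let $\lambda$ and $v$ be the wavelength and the speed of the incident light, respectively, so that its angular frequency is $\omega = 2\pi v/\lambda$. Let the spherical nanoparticle $D$ have permittivity $\epsilon_1=\epsilon_0\Big(1-\frac{\omega_p^2}{\omega(\omega+i\tau)}\Big)$. If $\lambda = 2\pi v\,\frac{\sqrt{3}}{\omega_p}$, then plasmon resonance happens, i.e. the energy $\mathcal{E}$ (depending on $\tau>0$) of the nanoparticle induced by the illumination of the incident light satisfies $$\lim_{\tau\to 0}\tau\,\mathcal{E}=\infty .$$
   Context: Setting: $D\subset\mathbb{R}^3$ is a ball of radius $r_{NP}>0$ centred at the origin (the nanoparticle). The surrounding medium $\mathbb{R}^3\setminus\overline{D}$ has permittivity $\epsilon_0>0$. The permittivity of $D$ obeys the Drude model $$\epsilon_1=\epsilon(\omega)=\epsilon_0\Big(1-\frac{\omega_p^2}{\omega(\omega+i\tau)}\Big),$$ where $\omega_p>0$ is the plasma frequency, $\omega>0$ is the angular frequency of the incident light, $\tau>0$ is the width of the resonance, and $i=\sqrt{-1}$. The wavelength is much larger than $r_{NP}$, so the incident electric field is taken to be uniform, $\mathbf{E}^{in}=\mathbf{E}_0$, with $\mathbf{E}_0$ a nonzero constant vector independent of $\tau$. The electric potential is taken to be of the form $$u(\mathbf{x})=\begin{cases}\mathbf{E}_0\cdot\mathbf{x}+\dfrac{\mathbf{E}_1\cdot\mathbf{x}}{|\mathbf{x}|^3}, & \mathbf{x}\in\mathbb{R}^3\setminus D,\\[2mm] \mathbf{E}_2\cdot\mathbf{x}, & \mathbf{x}\in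 D,\end{cases}$$ where the constant vectors $\mathbf{E}_1,\mathbf{E}_2\in\mathbb{C}^3$ are determined by the transmission conditions on $|\mathbf{x}|=r_{NP}$: $u$ is continuous across the sphere, and $\epsilon_0\,\partial_r u|^{+}=\epsilon_1\,\partial_r u|^{-}$ (where $+$ and $-$ denote limits from outside and from inside $D$). This gives $$\mathbf{E}_2=\frac{3\epsilon_0}{2\epsilon_0+\epsilon_1}\mathbf{E}_0 .$$ The energy of the nanoparticle is $$\mathcal{E}=\int_D|\mathbf{E}_2|^2\,d\mathbf{x}=\Big|\frac{3\epsilon_0}{2\epsilon_0+\epsilon_1}\Big|^2\int_D|\mathbf{E}_0|^2\,d\mathbf{x}.$$ Definition (plasmon resonance): with $\epsilon_1$ given by the Drude model, plasmon resonance is said to happen if $\lim_{\tau\to0}\tau\,\mathcal{E}=\infty$. *)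

(* Defs.v *)
From HB Require Import structures.
From mathcomp Require Import all_boot all_order all_algebra.
From mathcomp Require Import complex.
From mathcomp Require Import all_classical all_reals all_analysis.

Set Implicit Arguments.
Unset Strict Implicit.
Unset Printing Implicit Defensive.

Import Order.TTheory GRing.Theory Num.Theory.
Import numFieldNormedType.Exports.

Local Open Scope classical_set_scope.
Local Open Scope ring_scope.
Local Open Scope complex_scope.

Section Nanoparticle.
Context {R : realType}.
Local Notation C := R[i].

(* Points of R^3 and vectors of C^3 are triples: the library has a measurable
   structure and a product measure on pairs, but not on row vectors. *)

(* The norm provided by the library on a product is the sup norm. *)
Definition eucl (x : R * R * R) : R :=
  Num.sqrt (x.1.1 ^+ 2 + x.1.2 ^+ 2 + x.2 ^+ 2).

(* Bilinear, without conjugation. *)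
Definition cdot (E : C * C * C) (x : R * R * R) : C :=
  E.1.1 * (x.1.1)%:C + E.1.2 * (x.1.2)%:C + E.2 * (x.2)%:C.

Definition sqnorm (E : C * C * C) : R :=
  Normc.normc E.1.1 ^+ 2 + Normc.normc E.1.2 ^+ 2 + Normc.normc E.2 ^+ 2.

Definition nanoparticle (r : R) : set (R * R * R) := [set x | eucl x < r].

Definition potential (r : R) (E0 E1 E2 : C * C * C) (x : R * R * R) : C :=
  if eucl x < r then cdot E2 x
  else cdot E0 x + cdot E1 x / (eucl x ^+ 3)%:C.

(* The derivative of t |-> u (t nu), for a unit vector nu; it is taken on real
   and imaginary parts because the library's derivative of a function of a real
   variable requires a normed module over R as codomain, which C is not. *)
Definition radial_derivative (u : R * R * R -> C) (nu : R * R * R) (t : R) :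
    C^o :=
  derive1 (fun s : R => complex.Re (u (s *: nu))) t +i*
  derive1 (fun s : R => complex.Im (u (s *: nu))) t.

(* C^o is C with the topology of its modulus; the field C itself carries no
   canonical topology in the library. *)
Definition transmission (r eps0 : R) (eps1 : C) (u : R * R * R -> C) : Prop :=
  (forall x, eucl x = r -> {for x, continuous (u : R * R * R -> C^o)}) /\
  (forall nu, eucl nu = 1 ->
    exists dplus dminus : C^o,
      [/\ radial_derivative u nu t @[t --> r^'+] --> dplus,
          radial_derivative u nu t @[t --> r^'-] --> dminus &
          eps0%:C * dplus = eps1 * dminus]).

Definition drude (eps0 omegap omega tau : R) : C :=
  eps0%:C * (1 - (omegap ^+ 2)%:C / (omega%:C * (omega +i* tau))).

Definition volume := ((@lebesgue_measure R \x @lebesgue_measure R)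
  \x @lebesgue_measure R)%E.

Definition energy (r : R) (E2 : C * C * C) : \bar R :=
  (\int[volume]_(x in nanoparticle r) (sqnorm E2)%:E)%E.

Definition plasmon_resonance (energy_of : R -> \bar R) : Prop :=
  (tau%:E * energy_of tau)%E @[tau --> 0^'+] --> +oo%E.

End Nanoparticle.

(* Main.v *)
Require Import Defs.
From HB Require Import structures.
From mathcomp Require Import all_boot all_order all_algebra.
From mathcomp Require Import complex.
From mathcomp Require Import all_classical all_reals all_analysis.
From mathcomp Require Import measurable_realfun ring lra.
Import Order.TTheory GRing.Theory Num.Theory.
Import numFieldNormedType.Exports.
Local Open Scope classical_set_scope.
Local Open Scope ring_scope.
Local Open Scope complex_scope.

(** At the given wavelength the angular frequency is omegap / sqrt 3, that is
    omegap ^ 2 = 3 omega ^ 2. The Drude law then gives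
      2 eps0 + eps1 = 3 eps0 (1 - omega / (omega + i tau))
                    = 3 eps0 (i tau) / (omega + i tau),
    which vanishes with tau: this is the resonance of a sphere,
    eps1 -> - 2 eps0 (drude_resonance).

    The transmission conditions, read along a ray of direction nu, involve only
    the scalars a_j = E_j . nu. On the ray the potential is t a_0 + a_1 / t ^ 2
    outside and t a_2 inside, so continuity gives a_2 = a_0 + a_1 / r ^ 3, and
    the flux condition gives eps0 (a_0 - 2 a_1 / r ^ 3) = eps1 a_2. Eliminating
    a_1 leaves (2 eps0 + eps1) a_2 = 3 eps0 a_0 (transmission_radial), and the
    three coordinate directions recover the vector equation
    (transmission_field). Hence E2 = (omega + i tau) / (i tau) E0, so that
      |E2| ^ 2 = (omega ^ 2 + tau ^ 2) / tau ^ 2 |E0| ^ 2  (resonant_sqnorm).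

    The energy is |E2| ^ 2 times the volume of the ball. Therefore tau times
    the energy is at least a positive constant over tau, provided that the
    volume is bounded below by a positive number; a cube contained in the ball
    suffices for that (volume_nanoparticle_ge). *)

Section PlasmonResonance.
Context {R : realType}.
Local Notation C := R[i].
Set Implicit Arguments.
Unset Strict Implicit.

(** * The potential along a ray *)

Lemma eucl_scale (t : R) (nu : R * R * R) : eucl (t *: nu) = `|t| * eucl nu.
Proof.
rewrite /eucl /= -sqrtr_sqr -sqrtrM ?sqr_ge0//; congr Num.sqrt.
by rewrite /GRing.scale /=; ring.
Qed.

Lemma cdot_scale (E : C * C * C) (t : R) (nu : R * R * R) :
  cdot E (t *: nu) = t%:C * cdot E nu.
Proof. by rewrite /cdot /= !rmorphM /=; ring. Qed.

Lemma Re_scale (t : R) (z : C) : complex.Re (t%:C * z) = t * complex.Re z.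
Proof. by case: z => a b /=; rewrite mul0r subr0. Qed.

Lemma Im_scale (t : R) (z : C) : complex.Im (t%:C * z) = t * complex.Im z.
Proof. by case: z => a b /=; rewrite mul0r addr0. Qed.

Lemma potential_inside (r t : R) (E0 E1 E2 : C * C * C) (nu : R * R * R) :
  eucl nu = 1 -> 0 < t < r ->
  potential r E0 E1 E2 (t *: nu) = t%:C * cdot E2 nu.
Proof.
move=> nu1 /andP[t0 tr].
by rewrite /potential eucl_scale nu1 mulr1 gtr0_norm// tr cdot_scale.
Qed.

Lemma potential_outside (r t : R) (E0 E1 E2 : C * C * C) (nu : R * R * R) :
  eucl nu = 1 -> 0 < r <= t ->
  potential r E0 E1 E2 (t *: nu) =
    t%:C * cdot E0 nu + (t ^- 2)%:C * cdot E1 nu.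
Proof.
move=> nu1 /andP[r0 rt]; have t0 : 0 < t by exact: lt_le_trans rt.
rewrite /potential eucl_scale nu1 mulr1 gtr0_norm// ltNge rt /= !cdot_scale.
congr (_ + _); rewrite mulrAC -fmorphV -rmorphM; congr (_%:C * _).
by field; rewrite gt_eqF.
Qed.

(** * Limits of complex-valued functions by real and imaginary parts *)

Lemma cvg_Re (T : Type) (F : set_system T) {FF : Filter F} (f : T -> C^o)
    (l : C^o) : f @ F --> l -> (fun t => complex.Re (f t)) @ F --> complex.Re l.
Proof.
move=> /cvgrPdist_lt fl; apply/cvgrPdist_lt => e e0.
have e0C : 0 < e%:C :> C by rewrite ltcR.
near=> t; rewrite -ltcR; apply: le_lt_trans (_ : `|l - f t| < _).
  by rewrite -raddfB /= normc_ge_Re.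
by near: t; exact: fl.
Unshelve. all: by end_near. Qed.

Lemma cvg_Im (T : Type) (F : set_system T) {FF : Filter F} (f : T -> C^o)
    (l : C^o) : f @ F --> l -> (fun t => complex.Im (f t)) @ F --> complex.Im l.
Proof.
have ImE (z : C) : complex.Im z = complex.Re (- 'i * z).
  by case: z => a b /=; rewrite !oppr0 mul0r mulN1r opprK add0r.
move=> fl; under eq_fun do rewrite ImE; rewrite ImE.
apply: cvg_Re.
exact: (cvgM (cvg_cst _) fl).
Qed.

(** Identifies a limit in C from the real limits of the two components, which is
    how the real differential calculus of the components is transferred to the
    complex radial derivative. *)
Lemma cvg_complex_unique (T : Type) (F : set_system T) {FF : ProperFilter F}
    (f : T -> C^o) (l : C^o) (p q : T -> R) (x y : R) :
  f @ F --> l -> (\forall t \near F, f t = p t +i* q t) ->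
  p @ F --> x -> q @ F --> y -> l = x +i* y.
Proof.
move=> fl fE px qy; apply/eqP; rewrite eq_complex; apply/andP.
split; apply/eqP => /=.
  apply: (norm_cvg_unique (cvg_Re fl)).
  apply: cvg_trans px.
  by apply: near_eq_cvg; near=> t; rewrite (near fE t).
apply: (norm_cvg_unique (cvg_Im fl)).
apply: cvg_trans qy.
by apply: near_eq_cvg; near=> t; rewrite (near fE t).
Unshelve. all: by end_near. Qed.

Lemma complex_eta (z : C) : z = complex.Re z +i* complex.Im z.
Proof. by case: z. Qed.

(** * Radial derivatives *)

(** The functions t |-> t a + b / t ^ 2 are the radial profiles of both branches
    of the potential: the inside branch is the case b = 0. *)
Lemma derive1_radial_profile (a b t : R) : 0 < t ->
  derive1 (fun s : R => s * a + s ^- 2 * b) t = a - 2 * b / t ^+ 3.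
Proof.
move=> t0; have t20 : t ^+ 2 != 0 by rewrite expf_neq0// gt_eqF.
have dX : is_derive t (1 : R) (fun s : R => s ^- 2)
    (- (t ^+ 2) ^- 2 *: ((2%:R * t ^+ 1) *: (1 : R))).
  apply: (@is_deriveV R (fun s => s ^+ 2)) => //.
  exact: (@is_deriveX R R id 2 t 1 1 (is_derive_id t 1)).
have dL : is_derive t (1 : R) (fun s : R => s * a) a.
  by apply: is_derive_eq; rewrite ?scaler0 ?add0r /GRing.scale /= mulr1.
have dXb : is_derive t (1 : R) (fun s : R => s ^- 2 * b) (- 2 * b / t ^+ 3).
  apply: (is_derive_eq (is_deriveM dX (is_derive_cst b t 1))).
  rewrite /GRing.scale /=; field; exact: lt0r_neq0.
have [_ D] := is_deriveD dL dXb.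
by rewrite derive1E [LHS]D; ring.
Qed.

Lemma cvg_radial_profile_derivative (a b r : R) (F : set_system R)
    {FF : Filter F} :
  r != 0 -> F --> r -> a - 2 * b / t ^+ 3 @[t --> F] --> a - 2 * b / r ^+ 3.
Proof.
move=> r0 Fr; apply: cvgB; first exact: cvg_cst.
apply: cvgMr; apply: cvgV; first exact: expf_neq0.
by apply: cvgM => //; exact: cvgM.
Qed.

Lemma radial_derivative_profile (u : R * R * R -> C) (nu : R * R * R)
    (a b : C) (t : R) : 0 < t ->
  (\forall s \near t, u (s *: nu) = s%:C * a + (s ^- 2)%:C * b) ->
  radial_derivative u nu t =
    (complex.Re a - 2 * complex.Re b / t ^+ 3) +i*
    (complex.Im a - 2 * complex.Im b / t ^+ 3).
Proof.
move=> t0 ut; rewrite /radial_derivative -!derive1_radial_profile//.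
congr (_ +i* _); rewrite !derive1E; apply: near_eq_derive; near=> s.
  by rewrite (near ut s)// raddfD /= !Re_scale.
by rewrite (near ut s)// raddfD /= !Im_scale.
Unshelve. all: by end_near. Qed.

(** The radial derivative is known explicitly near r only, on one side; F stands
    for either of the one-sided filters at r. *)
Lemma radial_derivative_limit (u : R * R * R -> C) (nu : R * R * R)
    (a b : C) (r : R) (F : set_system R) {FF : ProperFilter F} (d : C^o) :
  0 < r -> F --> r ->
  (\forall t \near F,
     \forall s \near t, u (s *: nu) = s%:C * a + (s ^- 2)%:C * b) ->
  radial_derivative u nu t @[t --> F] --> d ->
  d = a - 2 * (r ^- 3)%:C * b.
Proof.
move=> r0 Fr uF ud; have rN0 : r != 0 by rewrite gt_eqF.
have F_gt0 : \forall t \near F, 0 < t by exact: (Fr _ (lt_nbhsr r0)).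
rewrite (cvg_complex_unique (x := complex.Re a - 2 * complex.Re b / r ^+ 3)
  (y := complex.Im a - 2 * complex.Im b / r ^+ 3) ud _
  (cvg_radial_profile_derivative rN0 Fr)
  (cvg_radial_profile_derivative rN0 Fr)); last first.
  near=> t; apply: radial_derivative_profile; near: t => //.
have -> : 2 * (r ^- 3)%:C * b = (2 / r ^+ 3)%:C * b.
  by rewrite rmorphM /= rmorph_nat.
rewrite [RHS]complex_eta !raddfB /= Re_scale Im_scale.
by congr (_ +i* _); ring.
Unshelve. all: by end_near. Qed.

(** * The transmission conditions *)

(** On the sphere the potential takes the value of its outside branch, so
    continuity is exploited by approaching the sphere from inside. *)
Lemma potential_radial_continuity (r : R) (E0 E1 E2 : C * C * C)
    (nu : R * R * R) : 0 < r -> eucl nu = 1 ->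
  {for r *: nu, continuous (potential r E0 E1 E2 : R * R * R -> C^o)} ->
  cdot E2 nu = cdot E0 nu + (r ^- 3)%:C * cdot E1 nu.
Proof.
move=> r0 nu1 ucont.
have rN0 : r != 0 by rewrite gt_eqF.
have rl : (r^'- : set_system R) --> r by exact: cvg_within.
set a0 := cdot E0 nu; set a1 := cdot E1 nu; set a2 := cdot E2 nu.
have ul : (fun t => potential r E0 E1 E2 (t *: nu) : C^o) @ r^'- -->
    (potential r E0 E1 E2 (r *: nu) : C^o).
  apply: (cvg_comp (fun t : R => t *: nu)
    (potential r E0 E1 E2 : R * R * R -> C^o) _ ucont).
  exact: (cvgZr_tmp rl).
have ui : \forall t \near r^'-, potential r E0 E1 E2 (t *: nu) =
    (t * complex.Re a2) +i* (t * complex.Im a2).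
  near=> t; rewrite potential_inside//.
    by rewrite [LHS]complex_eta Re_scale Im_scale.
  apply/andP; split; near: t; first exact: nbhs_left_gt.
  exact: nbhs_left_lt.
have Er : potential r E0 E1 E2 (r *: nu) = r%:C * a2.
  have rc (c : R) : t * c @[t --> r^'-] --> r * c by exact: cvgMl.
  rewrite (cvg_complex_unique ul ui (rc _) (rc _)).
  by rewrite [RHS]complex_eta Re_scale Im_scale.
have rC0 : r%:C != 0 :> C by rewrite fmorph_eq0.
apply: (mulfI rC0); rewrite -Er potential_outside ?r0 ?lexx//.
by rewrite [RHS]mulrDr [in RHS]mulrA -rmorphM; congr (_ + _%:C * _); field.
Unshelve. all: by end_near. Qed.

(** The scattered amplitude E1 . nu is eliminated between the continuity
    relation and the flux relation. *)
Lemma transmission_radial (r eps0 : R) (eps1 : C) (E0 E1 E2 : C * C * C)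
    (nu : R * R * R) : 0 < r -> eucl nu = 1 ->
  transmission r eps0 eps1 (potential r E0 E1 E2) ->
  (2 * eps0%:C + eps1) * cdot E2 nu = 3 * eps0%:C * cdot E0 nu.
Proof.
move=> r0 nu1 [ucont uflux].
have a2E : cdot E2 nu = cdot E0 nu + (r ^- 3)%:C * cdot E1 nu.
  apply: potential_radial_continuity => //; apply: ucont.
  by rewrite eucl_scale nu1 mulr1 gtr0_norm.
have [dplus [dminus [dplusP dminusP flux]]] := uflux _ nu1.
have dplusE : dplus = cdot E0 nu - 2 * (r ^- 3)%:C * cdot E1 nu.
  apply: radial_derivative_limit dplusP => //; first exact: cvg_within.
  near=> t; near=> s; apply: potential_outside => //; rewrite r0 /=.
  apply: ltW; near: s; apply: lt_nbhsr.
  by near: t; exact: nbhs_right_gt.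
have dminusE : dminus = cdot E2 nu - 2 * (r ^- 3)%:C * 0.
  apply: radial_derivative_limit dminusP => //; first exact: cvg_within.
  near=> t; near=> s; rewrite mulr0 addr0; apply: potential_inside => //.
  apply/andP; split; near: s; [apply: lt_nbhsr|apply: lt_nbhsl]; near: t.
    exact: nbhs_left_gt.
  exact: nbhs_left_lt.
rewrite mulr0 subr0 in dminusE.
have fluxC : eps0%:C * (cdot E0 nu - 2 * (r ^- 3)%:C * cdot E1 nu) =
    eps1 * cdot E2 nu by rewrite -dplusE -dminusE.
by rewrite mulrDl -fluxC a2E; ring.
Unshelve. all: by end_near. Qed.

Lemma transmission_field (r eps0 : R) (eps1 : C) (E0 E1 E2 : C * C * C) :
  0 < r -> transmission r eps0 eps1 (potential r E0 E1 E2) ->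
  [/\ (2 * eps0%:C + eps1) * E2.1.1 = 3 * eps0%:C * E0.1.1,
      (2 * eps0%:C + eps1) * E2.1.2 = 3 * eps0%:C * E0.1.2 &
      (2 * eps0%:C + eps1) * E2.2 = 3 * eps0%:C * E0.2].
Proof.
move=> r0 tr.
split.
- have := @transmission_radial r eps0 eps1 E0 E1 E2 (1, 0, 0) r0.
  rewrite /eucl /cdot /= !expr0n/= expr1n !addr0 sqrtr1 => /(_ erefl tr).
  by rewrite !mulr0 !mulr1 !addr0.
- have := @transmission_radial r eps0 eps1 E0 E1 E2 (0, 1, 0) r0.
  rewrite /eucl /cdot /= !expr0n/= expr1n addr0 add0r sqrtr1 => /(_ erefl tr).
  by rewrite !mulr0 !mulr1 !addr0 !add0r.
- have := @transmission_radial r eps0 eps1 E0 E1 E2 (0, 0, 1) r0.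
  rewrite /eucl /cdot /= !expr0n/= expr1n !add0r sqrtr1 => /(_ erefl tr).
  by rewrite !mulr0 !mulr1 !add0r.
Qed.

(** * The volume of the nanoparticle *)

Lemma nanoparticleE (r : R) : 0 < r ->
  nanoparticle r = [set x | x.1.1 ^+ 2 + x.1.2 ^+ 2 + x.2 ^+ 2 < r ^+ 2].
Proof.
move=> r0; apply/funext => x; congr is_true.
by rewrite /eucl -[ltRHS](gtr0_norm r0) -sqrtr_sqr ltr_sqrt// exprn_gt0.
Qed.

Lemma measurable_nanoparticle (r : R) : 0 < r -> measurable (nanoparticle r).
Proof.
move=> r0.
have m1 : measurable_fun setT (fun x : R * R * R => x.1.1).
  exact: (measurableT_comp measurable_fst measurable_fst).
have m2 : measurable_fun setT (fun x : R * R * R => x.1.2).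
  exact: (measurableT_comp measurable_snd measurable_fst).
have m3 : measurable_fun setT (fun x : R * R * R => x.2).
  exact: measurable_snd.
have mq : measurable_fun setT
    (fun x : R * R * R => x.1.1 ^+ 2 + x.1.2 ^+ 2 + x.2 ^+ 2).
  by apply: measurable_funD; [apply: measurable_funD|]; exact: measurable_funX.
have := mq measurableT `]-oo, r ^+ 2[%classic (measurable_itv _).
by rewrite setTI nanoparticleE.
Qed.

(** The cube ]0, r/2[ ^ 3 lies in the ball since 3 (r/2) ^ 2 < r ^ 2, and its
    measure is computed factor by factor. *)
Lemma volume_nanoparticle_ge (r : R) : 0 < r ->
  (((r / 2) ^+ 3)%:E <= volume (nanoparticle r))%E.
Proof.
move=> r0.
set I := `]0, (r / 2)[%classic.
have I0 : lebesgue_measure I = (r / 2)%:E.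
  by rewrite lebesgue_measure_itv /= lte_fin divr_gt0// oppr0 adde0.
have mI : measurable I by exact: measurable_itv.
have I2 : (lebesgue_measure \x lebesgue_measure)%E (I `*` I) =
    ((r / 2)%:E * (r / 2)%:E)%E.
  by apply: etrans (congr2 mule I0 I0); exact: product_measure1E.
have I3 : volume ((I `*` I) `*` I) = ((r / 2)%:E * (r / 2)%:E * (r / 2)%:E)%E.
  apply: etrans (congr2 mule I2 I0).
  by apply: product_measure1E => //; exact: measurableX.
rewrite 2!exprSr expr1 !EFinM -I3 /volume.
apply: le_measure; rewrite ?inE.
- by apply: measurableX => //; exact: measurableX.
- exact: measurable_nanoparticle.
rewrite nanoparticleE//.
move=> x [[]] /=; rewrite /I /= !in_itv /= => /andP[? ?] /andP[? ?] /andP[? ?].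
nra.
Qed.

Lemma energyE (r : R) (E : C * C * C) : 0 < r ->
  energy r E = ((sqnorm E)%:E * volume (nanoparticle r))%E.
Proof.
move=> r0; rewrite /energy /volume integral_cst//.
exact: measurable_nanoparticle.
Qed.

(** * Resonance *)

(** The relation omegap ^ 2 = 3 omega ^ 2 cancels the real part of the
    denominator: 3 (omega + i tau) - 3 omega = 3 i tau. The equation is
    multiplied by omega + i tau to avoid divisions. *)
Lemma drude_resonance (eps0 omegap omega tau : R) : 0 < omega ->
  omegap ^+ 2 = 3 * omega ^+ 2 ->
  (2 * eps0%:C + drude eps0 omegap omega tau) * (omega +i* tau) =
    3 * eps0%:C * (0 +i* tau).
Proof.
move=> w0 wp; rewrite /drude wp.
have wC : omega%:C != 0 :> C by rewrite fmorph_eq0 gt_eqF.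
have zE : omega +i* tau = omega%:C + (0 +i* tau).
  by rewrite [RHS]/= /GRing.add /= addr0 add0r.
have z0 : omega +i* tau != 0 :> C by rewrite eq_complex /= negb_and gt_eqF.
rewrite rmorphM rmorphXn /= rmorph_nat zE in z0 *; field.
by rewrite wC z0.
Qed.

Lemma sqnorm_scale (c : C) (E F : C * C * C) :
  E.1.1 = c * F.1.1 -> E.1.2 = c * F.1.2 -> E.2 = c * F.2 ->
  sqnorm E = Normc.normc c ^+ 2 * sqnorm F.
Proof.
by move=> e1 e2 e3; rewrite /sqnorm e1 e2 e3 !Normc.normcM; ring.
Qed.

Lemma sqnorm_gt0 (E : C * C * C) : E != 0 -> 0 < sqnorm E.
Proof.
move=> E0; have p (z : C) : 0 <= Normc.normc z ^+ 2 by exact: sqr_ge0.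
rewrite lt0r !addr_ge0// andbT; apply: contraNneq E0.
move=> /eqP; rewrite paddr_eq0 ?addr_ge0// paddr_eq0// !sqrf_eq0.
case: E => [[x y] z] /= /andP[/andP[]].
by do 3!move=> /eqP/Normc.eq0_normc->.
Qed.

Lemma normc_sqr (x y : R) : Normc.normc (x +i* y) ^+ 2 = x ^+ 2 + y ^+ 2.
Proof. by rewrite /= sqr_sqrtr// addr_ge0// sqr_ge0. Qed.

(** This is the square of the modulus of (omega + i tau) / (i tau); it
    blows up like 1 / tau ^ 2, one order faster than the factor tau of the
    definition of plasmon resonance decays. *)
Lemma resonant_sqnorm (r eps0 omegap omega tau : R) (E0 E1 E2 : C * C * C) :
  0 < r -> 0 < eps0 -> 0 < omega -> 0 < tau -> omegap ^+ 2 = 3 * omega ^+ 2 ->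
  transmission r eps0 (drude eps0 omegap omega tau)
    (potential r E0 E1 E2) ->
  sqnorm E2 = (omega ^+ 2 + tau ^+ 2) / tau ^+ 2 * sqnorm E0.
Proof.
move=> r0 e0 w0 t0 wp /(transmission_field r0)[e1 e2 e3].
have itau0 : 0 +i* tau != 0 :> C by rewrite eq_complex /= eqxx gt_eqF.
have eC0 : 3 * eps0%:C != 0 :> C.
  by rewrite mulf_neq0 ?pnatr_eq0// fmorph_eq0 gt_eqF.
have proportional (x y : C) :
    (2 * eps0%:C + drude eps0 omegap omega tau) * x = 3 * eps0%:C * y ->
    x = (omega +i* tau) / (0 +i* tau) * y.
  move=> xy; apply: (mulfI eC0); apply: (mulfI itau0).
  rewrite mulrCA mulrA [_ * (0 +i* tau)]mulrC.
  rewrite [0 +i* tau * _]mulrC -(drude_resonance eps0 tau w0 wp).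
  rewrite mulrAC xy; field.
  exact: itau0.
rewrite (sqnorm_scale (proportional _ _ e1) (proportional _ _ e2)
  (proportional _ _ e3)).
by rewrite Normc.normcM Normc.normcV exprMn exprVn !normc_sqr expr0n /= add0r.
Qed.

Lemma cvg_inv_at_right0 (k : R) : 0 < k -> k / tau @[tau --> 0^'+] --> +oo.
Proof.
move=> k0; under eq_fun do rewrite mulrC.
apply: gt0_cvgMly => //.
apply/(cvgrVy (f := id)); first exact: nbhs_right_gt.
exact: cvg_within.
Qed.

End PlasmonResonance.

Theorem theorem2p3 (R : realType) (rNP eps0 omegap lambda v omega : R)
    (E0 : R[i] * R[i] * R[i]) (E1 E2 : R -> R[i] * R[i] * R[i])
    (rNP_gt0 : 0 < rNP) (eps0_gt0 : 0 < eps0) (omegap_gt0 : 0 < omegap)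
    (lambda_gt0 : 0 < lambda) (v_gt0 : 0 < v) (E0_neq0 : E0 != 0)
    (omega_eq : omega = 2 * pi * v / lambda)
    (E12_transmission : forall tau : R, 0 < tau ->
       transmission rNP eps0 (drude eps0 omegap omega tau)
         (potential rNP E0 (E1 tau) (E2 tau)))
    (lambda_eq : lambda = 2 * pi * v * (Num.sqrt 3 / omegap)) :
  plasmon_resonance (fun tau => energy rNP (E2 tau)).
Proof.
have omegaE : omega = omegap / Num.sqrt 3.
  rewrite omega_eq lambda_eq; move: pi (pi_gt0 R) => p p_gt0; field.
  by rewrite !gt_eqF ?sqrtr_gt0.
have omega_gt0 : 0 < omega by rewrite omegaE divr_gt0// sqrtr_gt0.
have omegap2 : omegap ^+ 2 = 3 * omega ^+ 2.
  by rewrite omegaE expr_div_n sqr_sqrtr//; field.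
have S0 := sqnorm_gt0 E0_neq0.
(* Dropping the tau ^ 2 in omega ^ 2 + tau ^ 2 and bounding the volume by the
   cube leaves k / tau as a lower bound of tau times the energy. *)
pose k := omega ^+ 2 * sqnorm E0 * (rNP / 2) ^+ 3.
have k_gt0 : 0 < k by rewrite !mulr_gt0// ?exprn_gt0// divr_gt0.
have lower : (k / tau)%:E @[tau --> 0^'+] --> +oo%E.
  by apply/cvgeryP; exact: cvg_inv_at_right0.
apply: (gee_cvgy (g := fun tau => tau%:E * energy rNP (E2 tau))%E _ lower).
near=> tau.
have tau_gt0 : 0 < tau by near: tau; exact: nbhs_right_gt.
rewrite energyE// (resonant_sqnorm rNP_gt0 eps0_gt0 omega_gt0 tau_gt0 omegap2
  (E12_transmission tau tau_gt0)).
rewrite muleA -EFinM.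
apply: (@le_trans _ _ ((omega ^+ 2 * sqnorm E0 / tau)%:E *
    ((rNP / 2) ^+ 3)%:E)%E).
  by rewrite -EFinM lee_fin /k mulrAC.
apply: lee_pmul; rewrite ?lee_fin.
- by rewrite !mulr_ge0// ?sqr_ge0 ?invr_ge0 ltW.
- by rewrite exprn_ge0// ltW// divr_gt0.
- rewrite -subr_ge0 (_ : _ - _ = tau * sqnorm E0); last first.
    by field; rewrite gt_eqF.
  by rewrite mulr_ge0// ltW.
- exact: volume_nanoparticle_ge.
Unshelve. all: by end_near. Qed.
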